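(* Let $\mathcal{H}$ be a hypergraph on $n$ vertices with maximum degree $\Delta$ and minimum edge size $m$. For $m\geq 4$ and $q>\Delta$, the Markov chain $\mathcal{C}(\mathcal{H})$ (the Glauber dynamics on proper $q$-colourings of $\mathcal{H}$) mixes in time $O(n\log n)$.
   Context: A hypergraph $\mathcal{H}=(\mathcal{V},\mathcal{E})$ has a finite vertex set $\mathcal{V}$ with $|\mathcal{V}|=n$ and edges that are subsets of $\mathcal{V}$; the degree of a vertex is the number of edges containing it. A $q$-colouring $\mathcal{V}\to\{1,\dots,q\}$ is proper if no edge is monochromatic. Let $\Omega'(\mathcal{H})$ be the set of all proper $q$-colourings of $\mathcal{H}$. The Markov chain $\mathcal{C}(\mathcal{H})$ has state space $\Omega'(\mathcal{H})$ and the following transitions from $X_t$: select a vertex $v\in\mathcal{V}$ and a colour $k\in\{1,\dots,q\}$ uniformly at random; let $X'_t$ be the colouring obtained from $X_t$ by recolouring $v$ with colour $k$; if $X'_t$ is proper let $X_{t+1}=X'_t$, otherwise let $X_{t+1}=X_t$. Its stationary distribution $\pi$ is uniform on $\Omega'(\mathcal{H})$. The mixing time is $\tau(\varepsilon)=\min\{t:\max_x d_{TV}(P^{t'}(x,\cdot),\pi)\le\varepsilon\ \text{for all }t'\ge t\}$, where $P$ is the transition matrix and $d_{TV}$ is total variation distance. ''Mixes in time $O(n\log n)$'' is for fixed $q$, $\Delta$ and $\varepsilon\in(0,1)$ as $n\to\infty$, with implied constant depending only on these. *)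

(* Defs.v *)
From mathcomp Require Import all_boot all_order all_algebra.
From mathcomp Require Import reals.

Set Implicit Arguments.
Unset Strict Implicit.
Unset Printing Implicit Defensive.

Import Order.TTheory GRing.Theory Num.Theory.
Local Open Scope ring_scope.

Record hypergraph := Hypergraph {
  vertex : finType;
  edges : {set {set vertex}}
}.

Section Hypergraph.
Variable H : hypergraph.

Definition degree (v : vertex H) : nat := #|[set e in edges H | v \in e]|.

Definition max_degree : nat := \max_(v : vertex H) degree v.

(* A hypergraph without edges has no smallest edge; it then satisfies
   min_edge_size m for every m. *)
Definition min_edge_size (m : nat) : Prop :=
  (forall e, e \in edges H -> (m <= #|e|)%N) /\
  (edges H != set0 -> exists2 e, e \in edges H & #|e| = m).

Variable q : nat.

Definition colouring := {ffun vertex H -> 'I_q}.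

Definition monochromatic (X : colouring) (e : {set vertex H}) : bool :=
  [exists k, forall v in e, X v == k].

Definition proper_colouring (X : colouring) : bool :=
  [forall e in edges H, ~~ monochromatic X e].

Definition proper_colourings : finType :=
  {X : {ffun vertex H -> 'I_q} | proper_colouring X}.

Definition recolour (X : colouring) (v : vertex H) (k : 'I_q) : colouring :=
  [ffun w => if w == v then k else X w].

(* insubd X Y is Y if Y is proper, and X otherwise. *)
Definition glauber_step (X : proper_colourings) (v : vertex H) (k : 'I_q) :
  proper_colourings := insubd X (recolour (val X) v k).

End Hypergraph.

Section MarkovChain.
Variables (R : realType) (S : finType).

Definition tv_distance (mu nu : S -> R) : R :=
  2^-1 * \sum_(x : S) `|mu x - nu x|.

Definition uniform_distribution : S -> R := fun=> #|S|%:R^-1.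

(* The matrix is indexed by states through enum_rank and enum_val. *)
Definition law_at (P : 'M[R]_#|S|) (t : nat) (x : S) : S -> R :=
  fun y => (P ^+ t) (enum_rank x) (enum_rank y).

Definition worst_distance (P : 'M[R]_#|S|) (pi : S -> R) (t : nat) : R :=
  \big[Num.max/0]_(x : S) tv_distance (law_at P t x) pi.

Definition mixed_from (P : 'M[R]_#|S|) (pi : S -> R) (eps : R) (t : nat) :
  Prop := forall t', (t <= t')%N -> worst_distance P pi t' <= eps.

Definition is_mixing_time (P : 'M[R]_#|S|) (pi : S -> R) (eps : R) (t : nat) :
  Prop :=
  mixed_from P pi eps t /\ forall s, mixed_from P pi eps s -> (t <= s)%N.

End MarkovChain.

Arguments uniform_distribution R S : clear implicits.

Definition glauber_matrix (R : realType) (H : hypergraph) (q : nat) :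
  'M[R]_#|proper_colourings H q| :=
  \matrix_(i, j)
    \sum_(v : vertex H) \sum_(k : 'I_q)
      (glauber_step (enum_val i) v k == enum_val j)%:R
        / (#|vertex H| * q)%:R.

(* Main.v *)
Require Import Defs.
From mathcomp Require Import all_boot all_order all_algebra.
From mathcomp Require Import boolp reals sequences exp.

(* Path coupling with the identity coupling: both copies attempt the same
   recolouring.  Extend the dynamics to all colourings by refusing a move that
   makes an edge through the recoloured vertex monochromatic.  Let X and Y
   differ only at v.  An attempt (w, k) is costly if w = v and it is refused,
   or if w <> v and it creates a new disagreement.  A costly attempt is caused
   by an edge e containing v whose vertices other than v and w all have colour
   k, where w itself does not have colour k unless w = v; as |e| >= 4, e causes
   at most one costly attempt.  Hence at most Delta < q attempts are costly, while
   the other attempts at v make X and Y coalesce, so the Hamming distance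
   contracts by 1 - 1/(nq) on average.  Therefore P multiplies
   Lipschitz constants by 1 - 1/(nq), and testing P^t against sign functions
   bounds the total variation distance by n (1 - 1/(nq))^t. *)

Set Implicit Arguments.
Unset Strict Implicit.
Unset Printing Implicit Defensive.

Import Order.TTheory GRing.Theory Num.Theory.
Local Open Scope ring_scope.

(** * Hamming distance between colourings *)

Section Hamming.
Variables (H : hypergraph) (q : nat).
Implicit Types X Y Z : colouring H q.

Definition hamming X Y : nat := #|[set u | X u != Y u]|.

Lemma hamming_triangle Z X Y : (hamming X Y <= hamming X Z + hamming Z Y)%N.
Proof.
apply: leq_trans (leq_card_setU _ _).
apply/subset_leq_card/subsetP => u; rewrite !inE.
by apply: contraNT; rewrite negb_or !negbK => /andP[/eqP-> /eqP->].
Qed.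

Lemma hamming_eq0 X Y : (hamming X Y == 0)%N = (X == Y).
Proof.
rewrite cards_eq0; apply/eqP/eqP => [XY|->].
  by apply/ffunP => u; apply/eqP/negPn; have := in_set0 u; rewrite -XY inE => ->.
by apply/setP => u; rewrite !inE eqxx.
Qed.

Lemma hamming_le_card X Y : (hamming X Y <= #|vertex H|)%N.
Proof. exact: max_card. Qed.

Lemma hamming_le1 X Y v :
  (forall u, u != v -> X u = Y u) -> (hamming X Y <= 1)%N.
Proof.
move=> XY; rewrite -(cards1 v); apply/subset_leq_card/subsetP => u.
by rewrite !inE; apply: contraNT => /XY ->.
Qed.

Lemma hamming_le2 X Y v w :
  (forall u, u != v -> u != w -> X u = Y u) -> (hamming X Y <= 2)%N.
Proof.
move=> XY; apply: (@leq_trans #|[set v; w]|); last by rewrite cards2; case: eqP.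
apply/subset_leq_card/subsetP => u.
by rewrite !inE; apply: contraNT; rewrite negb_or => /andP[uv uw]; rewrite XY.
Qed.

(** Supplies the paths of path coupling: one recolouring brings [X] a step closer to [Y], possibly
    through an improper colouring. *)
Lemma hamming_recolour X Y v :
  X v != Y v -> hamming X Y = (hamming (recolour X v (Y v)) Y).+1.
Proof.
move=> XYv; rewrite /hamming (cardsD1 v) inE XYv add1n; congr _.+1.
apply: eq_card => u; rewrite !inE ffunE.
by have [->|] := eqVneq u v; rewrite ?eqxx.
Qed.

End Hamming.

(** * One-step contraction on the space of all colourings *)

Section ExtendedDynamics.
Variables (H : hypergraph) (q : nat).
Implicit Types (X Y : colouring H q) (v w : vertex H) (k : 'I_q).

(** Only edges through [v] are tested, so an edge already monochromatic elsewhere blocks nothing. *)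
Definition blocked X v k : bool :=
  [exists e in edges H, (v \in e) && [forall u in e, recolour X v k u == k]].

Definition extended_step X v k : colouring H q :=
  if blocked X v k then X else recolour X v k.

Lemma extended_step_other X v k u : u != v -> extended_step X v k u = X u.
Proof. by rewrite /extended_step; case: ifP => // _ /negPf uv; rewrite ffunE uv. Qed.

Lemma blockedP X v k :
  reflect (exists e, [/\ e \in edges H, v \in e &
                       forall u, u \in e -> u != v -> X u = k])
          (blocked X v k).
Proof.
apply: (iffP exists_inP) => [[e eH /andP[ve /forall_inP ek]]|[e [eH ve ek]]].
  by exists e; split => // u /ek /eqP + /negPf uv; rewrite ffunE uv.
exists e => //; rewrite ve; apply/forall_inP => u ue; rewrite ffunE.
by have [//|uv] := eqVneq u v; rewrite (ek u).
Qed.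

Lemma proper_recolour X v k :
  proper_colouring X -> proper_colouring (recolour X v k) = ~~ blocked X v k.
Proof.
move=> /forall_inP Xproper; apply/forall_inP/idP => [Xvk|].
  apply/negP => /exists_inP[e eH /andP[_ ek]].
  by move: (Xvk e eH); apply/negP/negPn/existsP; exists k.
move=> /exists_inPn Xvk e eH; apply: contra (Xvk e eH) => /existsP[c ec].
have [ve|vNe] := boolP (v \in e); last first.
  case/negP: (Xproper e eH); apply/existsP; exists c.
  apply/forall_inP => u ue; move/forall_inP/(_ u ue): ec; rewrite ffunE.
  by case: (u =P v) ue vNe => // -> ->.
(* As [v] lies in [e] and now has colour [k], the common colour [c] must be [k]. *)
have /forall_inP/(_ v ve) := ec; rewrite ffunE eqxx => /eqP kc.
by rewrite -kc in ec.
Qed.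

Lemma val_glauber_step (x : proper_colourings H q) v k :
  val (glauber_step x v k) = extended_step (val x) v k.
Proof.
rewrite /glauber_step val_insubd proper_recolour ?(valP x) // /extended_step.
by case: blocked.
Qed.

(* For [w = v] this says that [e] refuses the colour [k] at [v]. *)
Definition causes X v (p : vertex H * 'I_q) (e : {set vertex H}) : bool :=
  [&& e \in edges H, v \in e,
      [forall u in e, (u != v) && (u != p.1) ==> (X u == p.2)]
    & (p.1 == v) || (p.1 \in e) && (X p.1 != p.2)].

Definition costly X v : {set vertex H * 'I_q} :=
  [set p | [exists e, causes X v p e]].

(** Having four vertices, [e] contains one outside [v], [w], [w'], whose colour is both [k] and
    [k']. If [w] and [w'] differed, either of them, if not [v], would have colour [k] by the other's
    condition, against its own; so both would be [v]. *)
Lemma causes_inj X v (e : {set vertex H}) p p' :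
  (4 <= #|e|)%N -> causes X v p e -> causes X v p' e -> p = p'.
Proof.
case: p p' => [w k] [w' k'] e4.
case/and4P=> /= _ ve /forall_inP ek wP /and4P[/= _ _ /forall_inP ek' w'P].
have [u ue] : exists2 u, u \in e & u \notin [set v; w; w'].
  apply/subsetPn/negP => /subset_leq_card; rewrite leqNgt; case/negP.
  by rewrite (leq_ltn_trans _ e4) // setUC cardsU1 cards2; case: (_ \notin _); case: eqP.
rewrite !inE !negb_or -andbA => /and3P[uv uw uw'].
have kk' : k = k'.
  have:= ek u ue; have := ek' u ue.
  by rewrite uv uw uw' /= => /eqP <- /eqP <-.
subst k'; congr pair; apply/eqP/negPn/negP => ww'.
have wv : w == v.
  case/orP: wP => // /andP[we]; rewrite -[_ == v]negbK => Xw.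
  by apply: contra Xw => wv; have := ek' w we; rewrite wv ww'.
case/orP: w'P => [w'v|/andP[w'e]]; first by rewrite (eqP w'v) wv in ww'.
have [w'v|w'v] := eqVneq w' v; first by rewrite w'v wv in ww'.
by move: (ek w' w'e); rewrite w'v eq_sym ww' => /= ->.
Qed.

(** Sending a costly attempt to an edge that causes it is injective by [causes_inj], and such an
    edge contains [v]. *)
Lemma card_costly X v :
  (forall e, e \in edges H -> (4 <= #|e|)%N) ->
  (#|costly X v| <= degree v)%N.
Proof.
(* The default [set0] is never reached on costly attempts. *)
move=> e4; pose cause p := odflt set0 [pick e | causes X v p e].
have causeP p : p \in costly X v -> causes X v p (cause p).
  rewrite inE /cause => /existsP[e pe].
  by case: pickP => //= /(_ e); rewrite pe.
rewrite -(card_in_imset (f := cause)); last first.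
  move=> p p' /causeP cp /causeP cp'.
  have := cp; rewrite /causes => /and4P[/e4 c4 _ _ _] eq_c.
  by apply: causes_inj c4 cp _; rewrite eq_c.
apply/subset_leq_card/subsetP => _ /imsetP[p /causeP /and4P[eH ve _ _] ->].
by rewrite inE eH ve.
Qed.

Section Adjacent.
Variables (X Y : colouring H q) (v : vertex H).
Hypothesis XY : forall u, u != v -> X u = Y u.

(** An edge blocking [X] but not [Y] must contain [v], since the two agree off [v]; this edge is the
    cause. *)
Lemma costly_of_blocked w k :
  w != v -> X w != k -> blocked X w k -> ~~ blocked Y w k ->
  (w, k) \in costly X v.
Proof.
move=> wv Xw /blockedP[e [eH we ek]] /blockedP YNb.
rewrite inE; apply/existsP; exists e; apply/and4P; split => //=.
- apply/negPn/negP => vNe; apply: YNb; exists e; split => // u ue uw.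
  by rewrite -XY ?ek //; apply: contraNneq vNe => <-.
- by apply/forall_inP => u ue; apply/implyP => /andP[uv uw]; rewrite ek.
- by rewrite we Xw orbT.
Qed.

Lemma hamming_step_noop w k :
  w != v -> X w = k -> (hamming (extended_step X w k) (extended_step Y w k) <= 1)%N.
Proof.
move=> wv Xw; apply: (@hamming_le1 _ _ _ _ v) => u uv.
have [->|uw] := eqVneq u w; last by rewrite !extended_step_other ?XY.
have Yw : Y w = k by rewrite -XY.
by rewrite /extended_step; do 2 case: ifP => _; rewrite ?ffunE ?eqxx ?Xw ?Yw.
Qed.

End Adjacent.

(** [causes] never depends on the colour at [v], so costliness is symmetric in the two copies. *)
Lemma costly_eq X Y v : (forall u, u != v -> X u = Y u) -> costly X v = costly Y v.
Proof.
move=> XY; apply/setP => -[w k]; rewrite !inE; apply: eq_existsb => e.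
rewrite /causes; congr [&& _, _, _ & _] => /=.
  by apply: eq_forallb_in => u ue; have [//|uv] := eqVneq u v; rewrite XY.
by have [//|wv] := eqVneq w v; rewrite XY.
Qed.

(** Only [v] and [w] can disagree afterwards. A non-costly attempt at [v] is accepted by both
    copies, which then coincide; a non-costly one elsewhere leaves the copies equal at [w]. *)
Lemma hamming_step X Y v w k :
  (forall u, u != v -> X u = Y u) ->
  (hamming (extended_step X w k) (extended_step Y w k)
     <= (w != v) + ((w, k) \in costly X v))%N.
Proof.
move=> XY; have YX u : u != v -> Y u = X u by move=> /XY.
have [->|wv] := eqVneq w v.
  rewrite add0n; have [pC|pNC] := boolP (_ \in _).
    by apply: (@hamming_le1 _ _ _ _ v) => u uv; rewrite !extended_step_other ?XY.
  have Nb (Z : colouring H q) : (forall u, u != v -> X u = Z u) -> blocked Z v k = false.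
    move=> XZ; apply: contraNF pNC => /blockedP[e [eH ve ek]].
    rewrite inE; apply/existsP; exists e; apply/and4P; split; rewrite ?eqxx //=.
    by apply/forall_inP => u ue; apply/implyP => /andP[uv _]; rewrite XZ ?ek.
  rewrite leqn0 hamming_eq0 /extended_step !Nb //; apply/eqP/ffunP => u.
  by rewrite !ffunE; case: eqP => // /eqP /XY.
have [pC|pNC] := boolP (_ \in _).
  by apply: (@hamming_le2 _ _ _ _ v w) => u uv uw; rewrite !extended_step_other ?XY.
rewrite addn0; have [Xw|Xw] := eqVneq (X w) k; first exact: (hamming_step_noop XY).
(* A refusal by one copy alone would be costly; when that copy is [Y], [costly_eq] carries this back
   to [X]. *)
have eq_b : blocked X w k = blocked Y w k.
  apply/idP/idP; apply: contraTT => Nb; apply: contra pNC => b.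
    exact: (costly_of_blocked XY).
  by rewrite (costly_eq XY); apply: (costly_of_blocked YX); rewrite // -XY.
apply: (@hamming_le1 _ _ _ _ v) => u uv.
by rewrite /extended_step eq_b; case: ifP => _; rewrite ?ffunE XY.
Qed.

(** With [n] vertices, the [(n - 1) q] attempts off [v] count one each and costly ones add at most
    [q - 1]: in total [n q - 1]. *)
Lemma contraction_adjacent X Y v :
  (forall e, e \in edges H -> (4 <= #|e|)%N) -> (max_degree H < q)%N ->
  (forall u, u != v -> X u = Y u) ->
  (\sum_(p : vertex H * 'I_q)
     hamming (extended_step X p.1 p.2) (extended_step Y p.1 p.2)
   <= (#|vertex H| * q).-1)%N.
Proof.
move=> e4 degq XY.
have n0 : (0 < #|vertex H|)%N by apply/card_gt0P; exists v.
have ltq : (#|costly X v| < q)%N.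
  by apply: leq_ltn_trans (card_costly X v e4) (leq_ltn_trans (leq_bigmax v) degq).
apply: (@leq_trans (\sum_(p : vertex H * 'I_q) ((p.1 != v) + (p \in costly X v)))).
  by apply: leq_sum => -[w k] _; apply: hamming_step.
rewrite big_split /= -[in X in (_ + X <= _)%N]big_mkcond sum1_card.
rewrite -(pair_bigA _ (fun w (_ : 'I_q) => (w != v : nat))) /=.
under eq_bigr do rewrite sum_nat_const card_ord mulnC.
rewrite -big_distrl /= -big_mkcond sum1_card cardC1.
rewrite -[X in (_ <= (X * _).-1)%N](prednK n0) mulSn addnC -ltnS prednK; last first.
  by rewrite addn_gt0 (leq_ltn_trans _ ltq).
by rewrite -addSn leq_add2r.
Qed.

(** Induction along a path: the adjacent case handles [X] and [Z], the induction hypothesis [Z] and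
    [Y]. *)
Lemma contraction X Y :
  (forall e, e \in edges H -> (4 <= #|e|)%N) -> (max_degree H < q)%N ->
  (\sum_(p : vertex H * 'I_q)
     hamming (extended_step X p.1 p.2) (extended_step Y p.1 p.2)
   <= (#|vertex H| * q).-1 * hamming X Y)%N.
Proof.
move=> e4 degq; have [d] := ubnP (hamming X Y).
elim: d X => // d IH X; rewrite ltnS => leXYd.
have [/eqP|/set0Pn[v]] := eqVneq [set u | X u != Y u] set0.
  rewrite -cards_eq0 => XY; have /eqP -> : X == Y by rewrite -hamming_eq0.
  by rewrite big1 // => p _; apply/eqP; rewrite hamming_eq0.
rewrite inE => /[dup] XYv /hamming_recolour XY.
set Z := recolour X v (Y v) in XY.
have XZ u : u != v -> X u = Z u by rewrite ffunE => /negPf ->.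
rewrite XY mulnS; apply: leq_trans (leq_add (contraction_adjacent e4 degq XZ) (IH Z _)).
  by rewrite -big_split /=; apply: leq_sum => p _; apply: hamming_triangle.
by rewrite -XY.
Qed.

End ExtendedDynamics.

(** * The transition matrix: stationarity and decay of total variation *)

Section GlauberMatrix.
Variables (R : realType) (H : hypergraph) (q : nat).
Local Notation S := (proper_colourings H q).
Local Notation P := (glauber_matrix R H q).
Local Notation nq := ((#|vertex H| * q)%:R : R).
Hypothesis nq_gt0 : (0 < #|vertex H| * q)%N.

Let nq_neq0 : nq != 0. Proof. by rewrite pnatr_eq0 -lt0n. Qed.

Lemma mul_glauber (g : 'cV[R]_#|S|) (x : S) :
  (P *m g) (enum_rank x) 0 =
  nq^-1 * \sum_(p : vertex H * 'I_q) g (enum_rank (glauber_step x p.1 p.2)) 0.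
Proof.
rewrite mxE.
under eq_bigr => j _.
  rewrite mxE enum_rankK pair_bigA /= mulr_suml; over.
rewrite exchange_big /= mulr_sumr; apply: eq_bigr => p _.
rewrite (bigD1 (enum_rank (glauber_step x p.1 p.2))) //= enum_rankK eqxx.
rewrite big1 ?addr0 ?mul1r // => j jP.
rewrite (_ : _ == _ = false) ?mul0r //.
by apply: contraNF jP => /eqP ->; rewrite enum_valK.
Qed.

Lemma glauber_stochastic : P *m const_mx 1 = const_mx 1 :> 'cV[R]_#|S|.
Proof.
apply/colP => i; rewrite -(enum_valK i) mul_glauber [RHS]mxE.
under eq_bigr do rewrite mxE.
by rewrite sumr_const card_prod card_ord mulVf.
Qed.

(** A refused move stays at [x], so reaching another state [y] means that the recolouring itself is
    [y]. *)
Lemma glauber_step_eq (x y : S) v k : x != y ->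
  (glauber_step x v k == y) =
  (k == val y v) && [forall u, (u != v) ==> (val x u == val y u)].
Proof.
move=> xy; have -> : (glauber_step x v k == y) = (recolour (val x) v k == val y).
  apply/eqP/eqP => [/(congr1 val)|eq_y].
    rewrite val_insubd; case: ifP => // _ /val_inj eq_xy.
    by rewrite eq_xy eqxx in xy.
  by apply/val_inj; rewrite val_insubd eq_y (valP y).
apply/eqP/andP => [<-|[/eqP-> /forallP xy']].
  rewrite ffunE eqxx; split=> //; apply/forallP => u; apply/implyP => /negPf uv.
  by rewrite ffunE uv.
apply/ffunP => u; rewrite ffunE; case: eqP => [->//|/eqP uv].
by have := xy' u; rewrite uv => /eqP.
Qed.

(** Off the diagonal, each vertex [v] can contribute for one colour only, that of the target at [v],
    and does so when the two states agree off [v], a symmetric condition. *)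
Lemma glauber_symmetric : P^T = P.
Proof.
apply/matrixP => i j; rewrite !mxE; apply: eq_bigr => v _.
have [->//|ij] := eqVneq i j.
have vij : enum_val i != enum_val j by rewrite (inj_eq enum_val_inj).
have vji : enum_val j != enum_val i by rewrite eq_sym.
under eq_bigr do rewrite glauber_step_eq //.
under [RHS]eq_bigr do rewrite glauber_step_eq //.
rewrite (bigD1 (val (enum_val i) v)) // [RHS](bigD1 (val (enum_val j) v)) //=.
rewrite !eqxx !big1 ?addr0 => [|k /negPf->|k /negPf->]; rewrite ?mul0r //=.
congr (_%:R / _); congr nat_of_bool; apply: eq_forallb => u.
by rewrite [X in _ ==> X]eq_sym.
Qed.

Lemma glauber_stationary t :
  const_mx 1 *m P ^+ t = const_mx 1 :> 'rV[R]_#|S|.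
Proof.
have P1 : const_mx 1 *m P = const_mx 1 :> 'rV[R]_#|S|.
  rewrite -[P]glauber_symmetric -[const_mx 1 in LHS](trmx_const _ _ 1).
  by rewrite -trmx_mul glauber_stochastic trmx_const.
by elim: t => [|t IH]; rewrite ?expr0 ?mulmx1 // exprSr mulmxA IH.
Qed.

Definition lipschitz (L : R) (g : 'cV[R]_#|S|) : Prop :=
  forall x y : S,
    `|g (enum_rank x) 0 - g (enum_rank y) 0| <= L * (hamming (val x) (val y))%:R.

Hypothesis edge4 : forall e, e \in edges H -> (4 <= #|e|)%N.
Hypothesis degq : (max_degree H < q)%N.

(** Both averages run over the same attempts, so they are compared term by term and [contraction]
    bounds the sum of distances. *)
Lemma lipschitz_glauber L g : 0 <= L ->
  lipschitz L g -> lipschitz ((1 - nq^-1) * L) (P *m g).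
Proof.
move=> L0 gL x y; rewrite !mul_glauber -mulrBr -sumrB normrM.
rewrite ger0_norm ?invr_ge0 ?ler0n // ler_pdivrMl ?ltr0n //.
apply: le_trans (ler_norm_sum _ _ _) _.
apply: le_trans (ler_sum _ (fun p _ => gL _ _)) _.
rewrite -mulr_sumr -natr_sum.
under eq_bigr do rewrite !val_glauber_step.
have nq1 : nq * (1 - nq^-1) = (#|vertex H| * q).-1%:R.
  by rewrite mulrBr mulr1 mulfV // -subn1 natrB.
rewrite !mulrA nq1 [_ * L]mulrC -mulrA -natrM.
by apply: ler_wpM2l => //; rewrite ler_nat contraction.
Qed.

Lemma lipschitz_glauber_exp L g t : 0 <= L ->
  lipschitz L g -> lipschitz ((1 - nq^-1) ^+ t * L) (P ^+ t *m g).
Proof.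
move=> L0 gL; elim: t => [|t IH]; first by rewrite !expr0 mul1r mul1mx.
rewrite !exprS -mulrA -mulmxA; apply: lipschitz_glauber => //.
apply: mulr_ge0 => //; apply: exprn_ge0.
by rewrite subr_ge0 invf_le1 ?ltr0n // ler1n.
Qed.

Lemma sum_col n (u : 'cV[R]_n) : \sum_i u i 0 = ((const_mx 1 : 'rV_n) *m u) 0 0.
Proof. by rewrite mxE; apply: eq_bigr => i _; rewrite mxE mul1r. Qed.

(** Pairing [D] with its signs [g] gives twice the distance, namely [(P ^+ t *m g)] at [x] minus the
    mean of [g]. By stationarity that mean is also the mean of [P ^+ t *m g], so only differences of
    a Lipschitz function remain. *)
Lemma tv_glauber (x : S) t :
  tv_distance (law_at P t x) (uniform_distribution R S) <=
  (1 - nq^-1) ^+ t * #|vertex H|%:R.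
Proof.
pose D i := (P ^+ t) (enum_rank x) i - #|S|%:R^-1.
pose g : 'cV[R]_#|S| := \col_i Num.sg (D i).
have S0 : #|S|%:R != 0 :> R by rewrite pnatr_eq0 -lt0n; apply/card_gt0P; exists x.
(* Signs differ by at most 2, and distinct colourings are at distance at least 1. *)
have gL : lipschitz 2 g.
  move=> y z; have [->|yz] := eqVneq y z; first by rewrite subrr normr0 mulr_ge0.
  apply: (@le_trans _ _ 2).
    by rewrite !mxE (le_trans (ler_normB _ _)) // !normr_sg -natrD ler_nat;
       do 2 case: (_ == _).
  by rewrite ler_peMr // ler1n lt0n hamming_eq0 val_eqE.
have PgL := lipschitz_glauber_exp t (ler0n R 2) gL.
have sum_g : \sum_i (P ^+ t *m g) i 0 = \sum_i g i 0.
  by rewrite !sum_col mulmxA glauber_stationary.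
have sum_rank (F : 'I_#|S| -> R) : \sum_(z : S) F (enum_rank z) = \sum_i F i.
  by rewrite [RHS](reindex _ (onW_bij _ (enum_rank_bij S))).
have -> : tv_distance (law_at P t x) (uniform_distribution R S) =
    2^-1 * (#|S|%:R^-1 * \sum_(z : S)
      ((P ^+ t *m g) (enum_rank x) 0 - (P ^+ t *m g) (enum_rank z) 0)).
  rewrite sumrB sumr_const -(mulr_natl (_ _ 0)) mulrBr mulrA mulVf // mul1r.
  rewrite (sum_rank (fun i => (P ^+ t *m g) i 0)) sum_g.
  congr (_ * _); rewrite /law_at (sum_rank (fun i => `|D i|)).
  rewrite mxE mulr_sumr -sumrB; apply: eq_bigr => i _.
  by rewrite -mulrBl normrEsg mulrC mxE.
rewrite ler_pdivrMl // ler_pdivrMl ?lt0r ?S0 ?ler0n //.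
apply: (@le_trans _ _ (\sum_(z : S) (1 - nq^-1) ^+ t * 2 * #|vertex H|%:R)).
  apply: ler_sum => z _; apply: le_trans (ler_norm _) (le_trans (PgL _ _) _).
  apply: ler_wpM2l; last by rewrite ler_nat hamming_le_card.
  rewrite mulr_ge0 // exprn_ge0 //.
  by rewrite subr_ge0 invf_le1 ?ltr0n // ler1n.
by rewrite sumr_const -(mulr_natl (_ * _)) (mulrC _ 2) -mulrA.
Qed.

(** From [1 - a <= expR (- a)], the bound of [tv_glauber] is at most [n * expR (- t' / nq)] with [n]
    vertices, which is at most [eps] past the threshold. *)
Lemma mixed_from_glauber (eps : R) (t : nat) :
  0 < eps -> nq * (ln #|vertex H|%:R - ln eps) <= t%:R ->
  mixed_from P (uniform_distribution R S) eps t.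
Proof.
(* The first goal concerns the starting value [0] of the maximum. *)
move=> eps0 le_t t' tt'; apply: bigmax_le => [|x _]; first exact: ltW.
apply: le_trans (tv_glauber x t') _.
have n0 : 0 < #|vertex H|%:R :> R.
  by rewrite ltr0n; move: nq_gt0; rewrite muln_gt0 => /andP[].
have nq0 : 0 < nq by rewrite ltr0n.
apply: (@le_trans _ _ (expR (- nq^-1) ^+ t' * #|vertex H|%:R)).
  apply: ler_wpM2r; first exact: ltW.
  apply: lerXn2r; rewrite ?nnegrE ?expR_ge0 //.
    by rewrite subr_ge0 invf_le1 // ler1n.
  exact: expR_ge1Dx.
rewrite -expRM_natl -[X in _ * X](lnK n0) -expRD -[leRHS](lnK eps0) ler_expR.
rewrite addrC mulrN lerBlDr -lerBlDl ler_pdivlMr // mulrC.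
by apply: le_trans le_t _; rewrite ler_nat.
Qed.

End GlauberMatrix.

(** * Existence of the mixing time and the final estimate *)

Lemma mixing_time_le (R : realType) (S : finType) (P : 'M[R]_#|S|)
    (pi : S -> R) (eps : R) (t : nat) :
  mixed_from P pi eps t ->
  exists2 tau, is_mixing_time P pi eps tau & (tau <= t)%N.
Proof.
move=> mixed_t; have ex_mixed : exists s, `[< mixed_from P pi eps s >].
  by exists t; apply/asboolP.
case: (ex_minnP ex_mixed) => tau /asboolP mixed_tau min_tau.
by exists tau; [split => // s|]; move=> *; apply: min_tau; apply/asboolP.
Qed.

Theorem theorem5p1 (R : realType) (q Delta : nat) (hq : (Delta < q)%N)
    (eps : R) (heps0 : 0 < eps) (heps1 : eps < 1) :
  exists (C : R) (N : nat),
    forall (H : hypergraph) (n m : nat),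
      #|vertex H| = n -> (N <= n)%N ->
      max_degree H = Delta ->
      min_edge_size H m -> (4 <= m)%N ->
      exists tau : nat,
        is_mixing_time (glauber_matrix R H q)
          (uniform_distribution R (proper_colourings H q)) eps tau /\
        tau%:R <= C * (n%:R * ln n%:R).
Proof.
(* [N >= e] gives [1 <= ln n], so that the terms linear in [n] are absorbed. *)
exists (q%:R * (1 - ln eps) + 1), (Num.truncn (expR 1 : R)).+1.
move=> H n m cardH leNn degH [minH _] m4.
have lneps : 0 <= - ln eps by rewrite oppr_ge0 ln_le0 // ltW.
have n1 : 1 <= n%:R :> R by rewrite ler1n (leq_trans _ leNn).
have n0 : 0 < n%:R :> R by apply: lt_le_trans n1.
have ln1 : 1 <= ln n%:R :> R.
  rewrite -ler_expR lnK // ltW // (lt_le_trans (truncnS_gt _)) // ler_nat.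
  exact: leNn.
have nq_gt0 : (0 < #|vertex H| * q)%N.
  by rewrite cardH muln_gt0 (leq_trans _ leNn) // (leq_ltn_trans _ hq).
pose x : R := (#|vertex H| * q)%:R * (ln n%:R - ln eps).
have x0 : 0 <= x by rewrite mulr_ge0 // addr_ge0 // (le_trans _ ln1).
(* The threshold [x] is rounded up to a natural number, at a cost of at most 1. *)
have [|tau mix_tau le_tau] := @mixing_time_le _ _ (glauber_matrix R H q)
  (uniform_distribution R _) eps (Num.truncn x).+1.
  apply: mixed_from_glauber => //.
  - by move=> e /minH; apply: leq_trans.
  - by rewrite degH.
  - by rewrite [in ln _]cardH; apply/ltW/truncnS_gt.
exists tau; split => //.
apply: (@le_trans _ _ (x + 1)).
  apply: (@le_trans _ _ (Num.truncn x).+1%:R); first by rewrite ler_nat.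
  by rewrite -natr1 lerD2r truncn_le.
(* This absorbs both the rounding, paid by the [+ 1] in the constant, and the term in [- ln eps],
   which is linear in [n]. *)
have nln : n%:R <= n%:R * ln n%:R :> R by rewrite ler_peMr // ltW.
rewrite [leRHS]mulrDl mul1r lerD //; last exact: le_trans nln.
rewrite /x cardH natrM [n%:R * _]mulrC -mulrA -mulrA ler_wpM2l //.
rewrite mulrBr mulrBl mul1r lerD2l mulrC -!mulNr ler_wpM2l //.
Qed.
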